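(* Let $q$ be a prime power and let $\mathcal{E}=(V,E)$ be a strongly regular $q$-ary graph with parameters $(v,k,\lambda,\mu;q)$. Then at least one of the following holds: (i) $\mathcal{E}$ is the disjoint union of $\frac{q^{v}-1}{q^{k+1}-1}$ complete $q$-ary graphs on the elements of a $(k+1)$-spread of $\mathbb{F}_q^v$; that is, there is a $(k+1)$-spread $\mathcal{S}$ of $\mathbb{F}_q^v$ (which has $\frac{q^{v}-1}{q^{k+1}-1}$ elements) such that $E$ is the set of all $2$-dimensional subspaces contained in some element of $\mathcal{S}$; (ii) $v$ is even and there is a symplectic polarity $\varphi$ on $\mathbb{F}_q^v$ such that $E$ is the set of all totally isotropic $2$-dimensional subspaces of $\varphi$.
   Context: A $q$-ary graph with underlying vector space $W$ over $\mathbb{F}_q$ is a pair $\mathcal{E}=(V,E)$ where $V$ is the set of all $1$-dimensional subspaces of $W$ (the vertices) and $E$ is a set of $2$-dimensional subspaces of $W$ (the edges). Two vertices $X,Y$ are adjacent if the span $\langle X,Y\rangle$ is an element of $E$ (in particular $X\neq Y$). The neighborhood $N_{\mathcal{E}}(X)$ of a vertex $X$ is the set consisting of $X$ and all vertices adjacent to $X$. A set of $1$-dimensional subspaces is identified with a subspace $U$ when it is exactly the set of all $1$-dimensional subspaces of $U$. Let $v\ge 1$ and $k\ge 0$ be integers. A $q$-ary graph $\mathcal{E}$ with underlying vector space $\mathbb{F}_q^v$ is $k$-regular if for every vertex $X$ the neighborhood $N_{\mathcal{E}}(X)$ is a $(k+1)$-dimensional subspace of $\mathbb{F}_q^v$.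 A $k$-regular $q$-ary graph $\mathcal{E}$ with underlying vector space $\mathbb{F}_q^v$ is a strongly regular $q$-ary graph with parameters $(v,k,\lambda,\mu;q)$ ($\lambda,\mu$ integers) if for all vertices $X\ne Y$ the number of vertices in $(N_{\mathcal{E}}(X)\cap N_{\mathcal{E}}(Y))\setminus\{X,Y\}$ equals $\lambda$ if $X$ and $Y$ are adjacent, and equals $\mu$ otherwise. If no adjacent (resp. no non-adjacent) pairs of distinct vertices exist, the condition on $\lambda$ (resp. $\mu$) is vacuous and that parameter is arbitrary. A $(k+1)$-spread of $\mathbb{F}_q^v$ is a set of $(k+1)$-dimensional subspaces such that every $1$-dimensional subspace of $\mathbb{F}_q^v$ is contained in precisely one of them (the case $v=k+1$, where the spread is $\{\mathbb{F}_q^v\}$, is allowed). The complete $q$-ary graph on a vector space has all $2$-dimensional subspaces as edges. A symplectic polarity $\varphi$ on $\mathbb{F}_q^v$ is the map $U\mapsto U^{\perp}$ on subspaces induced by a non-degenerate alternating bilinear form on $\mathbb{F}_q^v$; a subspace $U$ is totally isotropic if $U\subseteq U^{\perp}$, i.e. the form vanishes identically on $U\times U$. *)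

(* Defs.v *)
From HB Require Import structures.
From mathcomp Require Import all_boot all_order all_algebra.

Set Implicit Arguments.
Unset Strict Implicit.
Unset Printing Implicit Defensive.

Import GRing.Theory.
Local Open Scope ring_scope.

Section FiniteSpaces.
Import VectorInternalTheory.

HB.instance Definition _ (F : finFieldType) (W : vectType F) :=
  [Countable of {vspace W} by <:].
HB.instance Definition _ (F : finFieldType) (W : vectType F) :=
  [Finite of {vspace W} by <:].

End FiniteSpaces.

Section QaryGraphs.
Variables (F : finFieldType) (W : vectType F).
Implicit Types (U X Y L : {vspace W}) (S : {set {vspace W}}).

(* The set of vertices that is identified with the subspace [U]. *)
Definition points U : {set {vspace W}} :=
  [set X : {vspace W} | (\dim X == 1)%N & (X <= U)%VS].

Definition vertices : {set {vspace W}} := [set X : {vspace W} | \dim X == 1%N].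

(* The vertex set is determined by [W], so only the edges are recorded. *)
Record qgraph := QGraph {
  edges :> {set {vspace W}};
  edges_dim : {in edges, forall L, \dim L = 2%N}
}.

Definition adjacent (G : qgraph) X Y : bool := (X + Y)%VS \in edges G.

Definition nbhd (G : qgraph) X : {set {vspace W}} :=
  [set Y in vertices | (Y == X) || adjacent G X Y].

Definition qregular (G : qgraph) (k : nat) : Prop :=
  forall X, X \in vertices ->
    exists2 U, \dim U = k.+1 & nbhd G X = points U.

(* [lambda] and [mu] are integers: when the corresponding set of pairs is empty
   the parameter is unconstrained, and may in particular be negative. *)
Definition strongly_regular (G : qgraph) (k : nat) (lambda mu : int) : Prop :=
  qregular G k /\
  forall X Y, X \in vertices -> Y \in vertices -> X != Y ->
    Posz #|(nbhd G X :&: nbhd G Y) :\: [set X; Y]| =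
      if adjacent G X Y then lambda else mu.

Definition spread (d : nat) S : Prop :=
  {in S, forall U, \dim U = d} /\
  forall X, X \in vertices -> exists! U, U \in S /\ (X <= U)%VS.

Definition complete_edges U : {set {vspace W}} :=
  [set L : {vspace W} | (\dim L == 2)%N & (L <= U)%VS].

(* Every alternating bilinear form is skew-symmetric, so taking [f] in
   [{skew_symmetric W}] loses nothing and gives access to [orthov]; in
   characteristic 2 the alternating condition is strictly stronger. *)
Definition symplectic_polarity (phi : {vspace W} -> {vspace W}) : Prop :=
  exists f : {skew_symmetric W},
    [/\ nondegenerate f, forall u, f u u = 0 & phi =1 orthov f].

Definition totally_isotropic (phi : {vspace W} -> {vspace W}) U : bool :=
  (U <= phi U)%VS.

End QaryGraphs.

(* Main.v *)
From HB Require Import structures.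
Require Import Defs.
From mathcomp Require Import all_boot all_order all_algebra.
From mathcomp Require Import all_field ring zify.

Set Implicit Arguments.
Unset Strict Implicit.
Unset Printing Implicit Defensive.

Import GRing.Theory Num.Theory.
Local Open Scope ring_scope.

(** Write N(x) for the subspace of dimension k+1 whose points are the
neighbours of the point spanned by x.  Membership y in N(x) is reflexive and
symmetric, and since N(x) is linear in y, symmetry makes it linear in x too:
a vector z of N(x) and N(y) also lies in N(w) for every w in the span of x, y.

If adjacency is transitive, two spaces N(x), N(y) coincide or meet trivially, so
they form a spread and its elements carry the complete graphs of case (i)
([spread_of_transitive]).

Otherwise there are adjacent and non-adjacent pairs with a common neighbour.
Strong regularity says that N(x) and N(y) meet in a space whose dimension is
some a for adjacent and some b > 0 for non-adjacent points.  Counting the pairs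
(y, z) with y in N(x) and z in N(y) but not in N(x) in two ways
([neighbour_double_count]) gives an equation between powers of q whose only
solutions ([gaussian_parameters]) have a = k and either v = k+2, or b = 1 and
v = 2k+1.

In the second family, let y be a common neighbour of non-adjacent x and z.
Inside N(y) the hyperplanes N(x) and N(z) meet in dimension at least k-1, so
k <= 2.  If k = 1 then v = k+2.  If k = 2 then points and edges form a
generalised pentagon of order (q, q), which is excluded by its spectrum, as in
the theorem of Feit and Higman: the two nontrivial eigenvalues are conjugate in
Q(sqrt 5), hence have equal multiplicity, and then the trace comes out wrong
([no_linear_pentagon]).

In the first family every N(x) is a hyperplane containing x, and x |-> N(x) is
injective on points: a null polarity.  It comes from an alternating form
([null_polarity_form]), which is constructed directly by normalising the linear
forms with kernel N(x), without the fundamental theorem of projective geometry.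
The form is nondegenerate because no N(x) is the whole space, so v is even
([alternating_even_dim]), and the edges are its totally isotropic lines. *)

(** * Coordinates along a complement of a hyperplane *)

Section HyperplaneCoordinate.
Variables (K : fieldType) (W : vectType K).
Implicit Types (U : {vspace W}) (w x y : W).

(** For a hyperplane [U] and [w] outside it, the linear form with kernel [U] and
value 1 at [w]. *)
Definition hcoord U w : W -> K := coord [tuple w] ord0 \o daddv_pi <[w]> U.

HB.instance Definition _ U w :=
  GRing.Linear.copy (hcoord U w) (coord [tuple w] ord0 \o daddv_pi <[w]> U).

Lemma hcoordP U w y : (\dim U).+1 = \dim {:W} -> w \notin U ->
  y - hcoord U w y *: w \in U.
Proof.
move=> dimU wNU.
have w0 : w != 0 by apply: contraNneq (wNU) => ->; exact: mem0v.
have capwU : (<[w]> :&: U = 0)%VS.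
  apply/eqP; rewrite -subv0; apply/subvP => _ /memv_capP[/vlineP[t ->] twU].
  rewrite memv0; case: (eqVneq t 0) => [->|t0]; first by rewrite scale0r.
  by rewrite -(scalerK t0 w) memvZ in wNU.
have yfull : y \in (<[w]> + U)%VS.
  have -> : (<[w]> + U)%VS = fullv; last exact: memvf.
  apply/eqP; rewrite eqEdim subvf dimv_disjoint_sum // dim_vline w0.
  by rewrite -dimU add1n leqnn.
have -> : hcoord U w y *: w = daddv_pi <[w]> U y.
  have : daddv_pi <[w]> U y \in <<[tuple w]>>%VS by rewrite span_seq1 memv_pi.
  by move/coord_span; rewrite big_ord1 => ->.
by rewrite -{1}(daddv_pi_add capwU yfull) addrC addKr memv_pi.
Qed.

Lemma hcoord_uniq U w y t : (\dim U).+1 = \dim {:W} -> w \notin U ->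
  y - t *: w \in U -> hcoord U w y = t.
Proof.
move=> dimU wNU ytU; apply/eqP; rewrite -subr_eq0; apply: contraNT (wNU) => st0.
rewrite -(scalerK st0 w) memvZ // scalerBl.
have := memvB ytU (hcoordP y dimU wNU).
by rewrite opprB addrC addrA subrK.
Qed.

Lemma hcoord_eq0 U w y : (\dim U).+1 = \dim {:W} -> w \notin U ->
  (hcoord U w y == 0) = (y \in U).
Proof.
move=> dimU wNU; apply/eqP/idP => [h0|yU].
  by have := hcoordP y dimU wNU; rewrite h0 scale0r subr0.
by apply: hcoord_uniq => //; rewrite scale0r subr0.
Qed.

End HyperplaneCoordinate.

(** * From null polarities to alternating forms *)

Section NullPolarity.
Variables (K : fieldType) (W : vectType K) (nb : W -> {vspace W}).
Hypothesis nb_refl : forall x, x \in nb x.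
Hypothesis nb_sym : forall x y, (y \in nb x) = (x \in nb y).
Hypothesis dim_nb : forall x, x != 0 -> (\dim (nb x)).+1 = \dim {:W}.
Hypothesis nb_inj : forall x y, x != 0 -> y != 0 -> nb x = nb y -> y \in <[x]>%VS.

Section Form.
Variables (e c : W).
Hypotheses (e0 : e != 0) (ce : c \notin nb e).

Let f := hcoord (nb e) c.
(* For [x] outside [nb e], the linear form with kernel [nb x] normalised by [phi x e = - f x]: this is
   the value forced on an alternating form with [f] as its row at [e]. *)
Let phi x := fun y => - (f x * hcoord (nb x) e y).

(** Outside the hyperplane [nb e] the form has rows [phi x].  Any [x] becomes a
vector outside it after adding [(1 - f x) *: c], and what is added is
subtracted again in the second summand. *)
Definition null_form x y := phi (x + (1 - f x) *: c) y + (f x - 1) * phi c y.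

Let f_eq0 x : (f x == 0) = (x \in nb e).
Proof. exact: hcoord_eq0 (dim_nb e0) ce. Qed.

Let fe0 : f e = 0. Proof. by apply/eqP; rewrite f_eq0. Qed.
Let fc1 : f c = 1.
Proof. by apply: (hcoord_uniq (dim_nb e0) ce); rewrite scale1r subrr mem0v. Qed.

Let fD x y : f (x + y) = f x + f y. Proof. exact: linearD. Qed.
Let fZ a x : f (a *: x) = a * f x. Proof. exact: linearZ. Qed.

Let f_neq0 x : f x != 0 -> x != 0.
Proof. by apply: contraNneq => ->; rewrite /f linear0. Qed.

Let eNnb x : f x != 0 -> e \notin nb x.
Proof. by rewrite f_eq0 nb_sym. Qed.

Let phiD x y z : phi x (y + z) = phi x y + phi x z.
Proof. by rewrite /phi linearD mulrDr opprD. Qed.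
Let phiZ x a y : phi x (a *: y) = a * phi x y.
Proof. by rewrite /phi linearZ /=; ring. Qed.

Let phi_eq0 x y : f x != 0 -> (phi x y == 0) = (y \in nb x).
Proof.
move=> fx; rewrite /phi oppr_eq0 mulf_eq0 (negPf fx) /=.
by rewrite (hcoord_eq0 _ (dim_nb (f_neq0 fx)) (eNnb fx)).
Qed.

(* The heart of the construction: independently normalised linear forms fit
   together.  The vector [z] below is orthogonal to both [e] and [x], hence, by
   symmetry and linearity, to the vector [y] of the space spanned by
   [x], [e] and [z] itself; this determines [phi y x] from [phi x y]. *)
Let phi_antisym x y : f x != 0 -> f y != 0 -> phi x y = - phi y x.
Proof.
move=> fx fy; have dx := dim_nb (f_neq0 fx); have dy := dim_nb (f_neq0 fy).
pose t := hcoord (nb x) e y.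
have yt : y - t *: e \in nb x := hcoordP y dx (eNnb fx).
pose z := f x *: y - f y *: x - (f x * t) *: e.
have ze : z \in nb e.
  by rewrite -f_eq0 /z /f !linearB !linearZ /= -/f fe0; apply/eqP; ring.
have zx : z \in nb x.
  have -> : z = f x *: (y - t *: e) - f y *: x.
    by rewrite /z scalerBr scalerA addrAC.
  by rewrite memvB ?memvZ.
have zy : z \in nb y.
  rewrite nb_sym -(scalerK fx y).
  have -> : f x *: y = z + f y *: x + (f x * t) *: e.
    by rewrite /z [_ - _ + _]addrAC !subrK.
  by apply/memvZ/memvD; [apply: memvD => // | ]; rewrite ?memvZ // nb_sym.
have xs : x - (- (f x * t / f y)) *: e \in nb y.
  rewrite -(scalerK fy (x - _)) memvZ // scaleNr opprK scalerDr scalerA.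
  rewrite mulrCA mulfV // mulr1.
  have -> : f y *: x + (f x * t) *: e = f x *: y - z.
    by rewrite /z !opprB [f x *: y + _]addrC addrA subrK addrC.
  by rewrite memvB ?memvZ.
by rewrite /phi -/t (hcoord_uniq dy (eNnb fy) xs); field.
Qed.

Let fDc x : f x == 0 -> f (x + c) != 0.
Proof. by move=> /eqP fx; rewrite fD fx fc1 add0r oner_neq0. Qed.

Let c_out : f c != 0. Proof. by rewrite fc1 oner_neq0. Qed.

(* A vector [y] of the hyperplane is the difference of [y + c] and [c], both of
   which lie outside it.  This carries every identity below from the complement
   of the hyperplane to the whole space. *)
Let outside_ext (g h : W -> K) :
    (forall u w, g (u + w) = g u + g w) -> (forall u w, h (u + w) = h u + h w) ->
  (forall y, f y != 0 -> g y = h y) -> g =1 h.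
Proof.
move=> gD hD gh y; case: (boolP (f y == 0)) => [fy|/gh//].
by apply/(addIr (g c)); rewrite -gD gh ?fDc // hD [g c]gh.
Qed.

Let BrD x y z : null_form x (y + z) = null_form x y + null_form x z.
Proof. by rewrite /null_form !phiD mulrDr addrACA. Qed.

(* By antisymmetry of [phi] the form is linear in its left argument when the
   right one lies outside the hyperplane. *)
Let B_right x y : f y != 0 -> null_form x y = - phi y x.
Proof.
move=> fy; have u1 : f (x + (1 - f x) *: c) != 0.
  by rewrite fD fZ fc1 mulr1 addrC subrK oner_neq0.
rewrite /null_form (phi_antisym u1 fy) (phi_antisym c_out fy) phiD phiZ.
by ring.
Qed.

Lemma null_form_addl x y z : null_form (x + y) z = null_form x z + null_form y z.
Proof.
move: z; apply: outside_ext => [u w|u w|z fz]; rewrite ?BrD //.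
  by rewrite addrACA.
by rewrite !B_right // phiD opprD.
Qed.

Lemma null_form_scalel a x z : null_form (a *: x) z = a * null_form x z.
Proof.
move: z; apply: outside_ext => [u w|u w|z fz]; rewrite ?BrD //.
  exact: mulrDr.
by rewrite !B_right // phiZ [RHS]mulrN.
Qed.

Let B_left x y : f x != 0 -> null_form x y = phi x y.
Proof.
move=> fx; move: y; apply: outside_ext => [u w|u w|z fz]; rewrite ?BrD ?phiD //.
by rewrite B_right // phi_antisym // opprK.
Qed.

Lemma null_form_skew x y : null_form x y = - null_form y x.
Proof.
move: y; apply: outside_ext => [u w|u w|y fy]; rewrite ?BrD ?null_form_addl //.
  exact: opprD.
by rewrite B_right // B_left.
Qed.

Let B_out x : f x != 0 -> null_form x x = 0.
Proof. by move=> fx; apply/eqP; rewrite B_left // phi_eq0. Qed.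

Lemma null_form_alternating x : null_form x x = 0.
Proof.
case: (boolP (f x == 0)) => [fx|/B_out//].
have := B_out (fDc fx); rewrite BrD !null_form_addl (B_out c_out) addr0.
by rewrite (null_form_skew c x) subrK.
Qed.

Lemma null_form_eq0 x y : (null_form x y == 0) = (y \in nb x).
Proof.
have out_l u w : f u != 0 -> (null_form u w == 0) = (w \in nb u).
  by move=> fu; rewrite B_left // phi_eq0.
have out_r u w : f w != 0 -> (null_form u w == 0) = (w \in nb u).
  by move=> fw; rewrite null_form_skew oppr_eq0 out_l // nb_sym.
case: (boolP (f y == 0)) => fy; last exact: out_r.
case: (eqVneq x 0) => [->|x0].
  have -> : null_form 0 y = 0 by rewrite -(scale0r e) null_form_scalel; apply: mul0r.
  by rewrite nb_sym mem0v eqxx.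
(* Only the point of [e] has a neighbour space inside [nb e]; the row of the form
   at [e] is [f]. *)
case: (boolP (nb x <= nb e)%VS) => [nxe|].
  have nbxe : nb x = nb e.
    by apply/eqP; rewrite eqEdim nxe -ltnS (dim_nb e0) (dim_nb x0) /=.
  have /vlineP[a xE] := nb_inj e0 x0 (esym nbxe).
  rewrite nbxe -f_eq0 fy xE null_form_scalel; suff -> : null_form e y = 0 by rewrite mulr0 eqxx.
  have B_e z : f z != 0 -> null_form e z = f z.
    move=> fz; rewrite B_right // /phi opprK.
    rewrite (hcoord_uniq (dim_nb (f_neq0 fz)) (eNnb fz) (t := 1)) ?mulr1 //.
    by rewrite scale1r subrr mem0v.
  apply/(addIr (null_form e c)); rewrite -BrD !B_e ?fDc // add0r.
  by rewrite fD (eqP fy) add0r.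
(* Otherwise translate [y] out of the hyperplane within its class modulo [nb x]. *)
case/subvPn => u unx; rewrite -f_eq0 => fu.
have fyu : f (y + u) != 0 by rewrite fD (eqP fy) add0r.
have /eqP xu0 : null_form x u == 0 by rewrite out_r.
have -> : null_form x y = null_form x (y + u) by rewrite BrD xu0 addr0.
rewrite out_r //.
by apply/idP/idP => [yu|ynx]; [rewrite -(addrK u y) memvB | rewrite memvD].
Qed.

End Form.
End NullPolarity.

Lemma skew_form_of (K : fieldType) (W : vectType K) (B : W -> W -> K) :
    (forall x y z, B (x + y) z = B x z + B y z) ->
    (forall a x z, B (a *: x) z = a * B x z) ->
    (forall x y, B x y = - B y x) ->
  exists f : {skew_symmetric W}, f =2 B.
Proof.
move=> BD BZ Bs.
have Bfor : bilinear_for *%R (@idfun K \; *%R) B.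
  split=> u a x y /=; first by rewrite BD BZ.
  by rewrite Bs BD BZ opprD -mulrN -!Bs.
pose m1 := bilinear_isBilinear.Build K W W K *%R (@idfun K \; *%R) B Bfor.
have Bh x y : B x y = (-1) ^+ true * @idfun K (B y x) by rewrite mulN1r -Bs.
pose m2 := isHermitianSesquilinear.Build K W true (@idfun K) B Bh.
pose f : {skew_symmetric W} := HB.pack B m1 m2.
by exists f.
Qed.

(** Induction on the dimension: if [f x y] is nonzero, the vectors of [U]
orthogonal to [x] and [y] form a subspace of codimension 2 on which [f] is still
nondegenerate, since [U] is its sum with the plane of [x] and [y]. *)
Lemma alternating_even_dim (K : fieldType) (W : vectType K)
    (f : {skew_symmetric W}) (U : {vspace W}) :
    (forall u, f u u = 0) -> (U :&: orthov f U = 0)%VS -> ~~ odd (\dim U).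
Proof.
move=> falt; move: {2}(\dim U) (leqnn (\dim U)) => n.
elim: n U => [|n IHn] U; first by rewrite leqn0 => /eqP->.
move=> dimU radU; case: (eqVneq U 0%VS) => [->|U0]; first by rewrite dimv0.
have [x xU x0] : exists2 x, x \in U & x != 0.
  by exists (vpick U); rewrite ?memv_pick // vpick0.
have xNorth : x \notin orthov f U.
  apply: contraNN x0 => xo; rewrite -memv0 -radU memv_cap xU xo //.
have [y yU fxy] := mem_orthovPn xNorth.
set U1 := (U :&: orthov f <[x]>)%VS; set U2 := (U1 :&: orthov f <[y]>)%VS.
have dimU1 : (\dim U).-1 = \dim U1 by apply: eq_dim_orthov1.
have xU1 : x \in U1 by rewrite memv_cap xU mem_orthov1 falt eqxx.
have yNU1 : y \notin orthov f U1.
  by apply/mem_orthovPn; exists x => //; rewrite herm_eq0C.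
have dimU2 : (\dim U1).-1 = \dim U2 by apply: eq_dim_orthov1.
have U1gt0 : (0 < \dim U1)%N.
  by rewrite lt0n dimv_eq0; apply: contraNneq x0 => U10; rewrite -memv0 -U10.
have fyx : f y x = - f x y by rewrite hermC /= mulN1r.
have dimUE : \dim U = (\dim U2).+2 by rewrite -dimU2 prednK // -dimU1 prednK //; lia.
rewrite dimUE /= negbK; apply: IHn; first by lia.
apply/eqP; rewrite -subv0; apply/subvP => z /memv_capP[zU2 zo].
have /memv_capP[/memv_capP[zU]] := zU2.
rewrite !mem_orthov1 => /eqP zx /eqP zy.
rewrite -radU memv_cap zU; apply/mem_orthovP => u uU.
(* The projection of [u] along the plane of [x] and [y]. *)
pose u' := u - (f u y / f x y) *: x - (f u x / f y x) *: y.
have u'U2 : u' \in U2.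
  rewrite /U2 /U1 !memv_cap !mem_orthov1 /u' !linearBl !linearZl_LR /= !falt.
  rewrite !memvB ?memvZ //= fyx.
  by apply/andP; split; apply/eqP; field; rewrite ?oppr_eq0; apply/andP.
have := mem_orthovP zo u' u'U2.
by rewrite /u' !linearBr /= !linearZr_LR /= zx zy !mulr0 !subr0.
Qed.

(** A symmetric assignment of hyperplanes to points that is injective and for
which every point is absolute is orthogonality for an alternating form. *)
Lemma null_polarity_form (K : fieldType) (W : vectType K)
    (nb : W -> {vspace W}) :
    (forall x, x \in nb x) -> (forall x y, (y \in nb x) = (x \in nb y)) ->
    (forall x, x != 0 -> (\dim (nb x)).+1 = \dim {:W}) ->
    (forall x y, x != 0 -> y != 0 -> nb x = nb y -> y \in <[x]>%VS) ->
    (0 < \dim {:W})%N ->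
  exists f : {skew_symmetric W},
    (forall u, f u u = 0) /\ (forall x y, (f x y == 0) = (y \in nb x)).
Proof.
move=> nb_refl nb_sym dim_nb nb_inj W0.
pose e := vpick {:W}.
have e0 : e != 0 by rewrite vpick0 -dimv_eq0 -lt0n.
have [c ce] : exists c, c \notin nb e.
  suff /subvPn[c _ ce] : ~~ (fullv <= nb e)%VS by exists c.
  by apply/negP => /dimvS; rewrite -(dim_nb e e0) ltnn.
have [f fE] := skew_form_of (null_form_addl nb_refl nb_sym dim_nb e0 ce)
  (null_form_scalel nb_refl nb_sym dim_nb e0 ce)
  (null_form_skew nb_refl nb_sym dim_nb e0 ce).
exists f; split=> [u|x y]; rewrite fE.
  exact: (null_form_alternating nb_refl nb_sym dim_nb e0 ce).
exact: (null_form_eq0 nb_refl nb_sym dim_nb nb_inj e0 ce).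
Qed.

(** * A spectral obstruction to generalised pentagons *)

(** Factor [P] as a column basis times a row basis: idempotency says that the
product in the other order is an identity matrix, which has the same trace. *)
Lemma mxtrace_idempotent (K : fieldType) n (P : 'M[K]_n) :
  P *m P = P -> \tr P = (\rank P)%:R.
Proof.
move=> PP; rewrite -[in LHS](mulmx_base P) mxtrace_mulC.
suff -> : row_base P *m col_base P = 1%:M by rewrite mxtrace1.
have inj1 := row_free_inj (row_base_free P).
have inj2 : injective (mulmx (col_base P) : 'M_(\rank P) -> _).
  by apply: row_full_inj; apply: col_base_full.
apply: inj2; apply: inj1; rewrite mulmx1 mulmxA mulmx_base -mulmxA.
by rewrite mulmx_base.
Qed.

(** Otherwise the exponent of 5 would be even on the left and odd on the right. *)
Lemma sqr_eq_5sqr (m n : nat) : (m ^ 2 = 5 * n ^ 2 -> m = 0)%N.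
Proof.
move=> h; apply/eqP; rewrite eqn0Ngt; apply/negP => m0.
have n0 : (0 < n)%N.
  by case: n h => // h; nia.
have := congr1 (odd \o logn 5) h.
by rewrite /= lognM ?expn_gt0 ?n0 // !lognX (pfactorK 1) // !mul2n oddD !odd_double.
Qed.

(** Think of [E] as the identity, of [A] as the reflexive adjacency matrix of a
generalised pentagon of order (q, q), and of [L] as the all-ones matrix.  Away
from the all-ones vector, [A] satisfies x^2 = q x + q^2, so its eigenvalues there
are q (1 +- sqrt 5) / 2.  The projection [P] onto the eigenspace for the sign +
is a combination of [E], [A], [L], and its trace is its rank, an integer; but the
trace formula puts that integer in Q(sqrt 5) with a nonzero irrational part. *)
Lemma pentagon_matrices_absurd (K : numFieldType) (s : K) (N q m n : nat)
    (E A L : 'M[K]_N) : s ^+ 2 = 5 -> (1 < q)%N ->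
    m = (q ^ 2 + q + 1)%N -> n = (q ^ 4 + q ^ 3 + m)%N ->
    E *m E = E -> E *m A = A -> A *m E = A -> E *m L = L -> L *m E = L ->
    A *m L = m%:R *: L -> L *m A = m%:R *: L -> L *m L = n%:R *: L ->
    A *m A = L + q%:R *: A + (q ^ 2)%:R *: E ->
    \tr E = n%:R -> \tr A = n%:R -> \tr L = n%:R -> False.
Proof.
move=> s5 q1 mq nq EE EA AE EL LE AL LA LL AA trE trA trL.
have ss : s * s = 5 by rewrite -expr2.
have s0 : s != 0 by rewrite -sqrf_eq0 s5 pnatr_eq0.
have q0 : q%:R != 0 :> K by rewrite pnatr_eq0; lia.
have n0 : n%:R != 0 :> K by rewrite pnatr_eq0; lia.
(* The coefficients of [P]; [d] is such that [P] kills the all-ones vector. *)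
pose a : K := (1 - s^-1) / 2; pose b : K := (q%:R * s)^-1.
pose d := - (a + b * m%:R) / n%:R.
have two0 : 2 != 0 :> K by rewrite pnatr_eq0.
have aE : a * a + b * b * (q ^ 2)%:R = a.
  have s2 : s^-1 * s^-1 = 5^-1 by rewrite -invfM ss.
  have -> : b * b * (q ^ 2)%:R = 5^-1 by rewrite -s2 natrX /b; field; apply/andP.
  have -> : a * a = (1 + s^-1 * s^-1 - 2 * s^-1) / 4.
    by rewrite /a; field.
  by rewrite s2 /a; field.
have bE : 2 * a * b + b * b * q%:R = b by rewrite /a /b; field; apply/andP.
have mE : m%:R = q%:R ^+ 2 + q%:R + 1 :> K by rewrite mq !natrD natrX.
have nE : n%:R = m%:R ^+ 2 - q%:R * m%:R - q%:R ^+ 2 :> K.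
  by rewrite nq !natrD !natrX mE; ring.
have dE : b * b + 2 * a * d + 2 * b * d * m%:R + d * d * n%:R = d.
  have tE : (a + b * m%:R) * (a + b * m%:R) = a + b * m%:R + n%:R * (b * b).
    have -> : (a + b * m%:R) * (a + b * m%:R) =
        a * a + (2 * a * b) * m%:R + b * b * m%:R ^+ 2 by ring.
    have -> : a * a = a - b * b * (q ^ 2)%:R by apply/esym/eqP; rewrite subr_eq aE.
    have -> : 2 * a * b = b - b * b * q%:R by apply/esym/eqP; rewrite subr_eq bE.
    by rewrite nE natrX; ring.
  have -> : b * b + 2 * a * d + 2 * b * d * m%:R + d * d * n%:R =
      b * b + 2 * d * (a + b * m%:R) +
      (a + b * m%:R) * (a + b * m%:R) / n%:R by rewrite /d; field.
  have -> : 2 * d * (a + b * m%:R) =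
     - 2 * ((a + b * m%:R) * (a + b * m%:R)) / n%:R by rewrite /d; field.
  by rewrite tE /d; field.
pose P := a *: E + b *: A + d *: L.
have PP : P *m P = P.
  rewrite /P !mulmxDl !mulmxDr -!scalemxAl -!scalemxAr.
  rewrite EE EA AE EL LE AL LA LL AA !scalerA !scalerDr !scalerA.
  apply/matrixP => i j; rewrite !mxE.
  transitivity ((a * a + b * b * (q ^ 2)%:R) * E i j
    + (2 * a * b + b * b * q%:R) * A i j
    + (b * b + 2 * a * d + 2 * b * d * m%:R + d * d * n%:R) * L i j); first by ring.
  by rewrite aE bE dE.
have := mxtrace_idempotent PP.
rewrite /P !mxtraceD !mxtraceZ trE trA trL; set r := \rank P => rE.
(* The integrality condition, cleared of denominators: [t = s * u]. *)
pose t : int := Posz q ^+ 4 - Posz q ^+ 3 - Posz q ^+ 2 + Posz q.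
pose u : int := Posz n - 1 - 2 * Posz r.
have tE : t%:~R = q%:R ^+ 4 - q%:R ^+ 3 - q%:R ^+ 2 + q%:R :> K.
  by rewrite /t rmorphD !rmorphB /= !rmorphXn /=.
have uE : u%:~R = n%:R - 1 - 2 * r%:R :> K by rewrite /u !rmorphB /= rmorphM /=.
have key : t%:~R = s * u%:~R.
  have n1 : n%:R - 1 = q%:R ^+ 4 + q%:R ^+ 3 + q%:R ^+ 2 + q%:R :> K.
    by rewrite nq mq !natrD !natrX; ring.
  have nm : n%:R - m%:R = q%:R ^+ 4 + q%:R ^+ 3 :> K.
    by rewrite nq !natrD !natrX; ring.
  have rE' : r%:R = a * (n%:R - 1) + b * (n%:R - m%:R).
    have dn : d * n%:R = - (a + b * m%:R) by rewrite /d divfK.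
    by rewrite -rE dn; ring.
  rewrite tE uE rE' n1 nm /a /b; field; exact/andP.
have key2 : (`|t| ^ 2 = 5 * `|u| ^ 2)%N.
  have : (t ^+ 2)%:~R = (5 * u ^+ 2)%:~R :> K.
    by rewrite [LHS]rmorphXn [RHS]rmorphM [in RHS]rmorphXn /= key exprMn s5.
  by move/intr_inj/(congr1 absz); rewrite abszM !abszX.
have /eqP := sqr_eq_5sqr key2; rewrite absz_eq0 /t.
have -> : Posz q ^+ 4 - Posz q ^+ 3 - Posz q ^+ 2 + Posz q
  = Posz q * (Posz q - 1) ^+ 2 * (Posz q + 1) by ring.
by rewrite !mulf_eq0 -!orbA; lia.
Qed.

Section MatrixOfFunction.
Variables (T : finType) (R : pzRingType).
Definition mxf (f : T -> T -> R) : 'M[R]_#|T| :=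
  \matrix_(i, j) f (enum_val i) (enum_val j).

Lemma mxf_mul f g : mxf f *m mxf g = mxf (fun x y => \sum_z f x z * g z y).
Proof.
apply/matrixP => i j; rewrite !mxE [RHS]big_enum_val /=.
by apply: eq_bigr => k _; rewrite !mxE.
Qed.

Lemma mxf_trace f : \tr (mxf f) = \sum_x f x x.
Proof.
rewrite /mxtrace [RHS]big_enum_val /=.
by apply: eq_bigr => k _; rewrite !mxE.
Qed.

End MatrixOfFunction.

Section Pentagon.
Variables (F : finFieldType) (v : nat).
Local Notation W := 'rV[F]_v.
Let q := #|F|.

Definition nonzero_vectors (U : {vspace W}) : {set W} :=
  [set x | (x != 0) && (x \in U)].

Lemma card_nonzero_vectors (U : {vspace W}) :
  #|nonzero_vectors U| = (#|F| ^ \dim U - 1)%N.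
Proof.
rewrite -card_vspace [in RHS](cardD1 (0 : W)) mem0v add1n subn1 /=.
by rewrite cardsE; apply: eq_card => x; rewrite !inE.
Qed.

Lemma dim_rowspace : \dim {:W} = v.
Proof. by rewrite dimvf dim_matrix; apply: mul1n. Qed.

Lemma dim_line_cap (x : W) (U : {vspace W}) :
  x != 0 -> \dim (<[x]> :&: U) = (x \in U).
Proof.
move=> x0; case: (boolP (x \in U)) => [xU|xNU].
  by rewrite (capv_idPl _) // dim_vline x0.
suff -> : (<[x]> :&: U = 0)%VS by rewrite dimv0.
apply/eqP; rewrite -subv0; apply/subvP => _ /memv_capP[/vlineP[k ->] kxU].
case: (eqVneq k 0) => [->|k0]; first by rewrite scale0r mem0v.
by rewrite -(scalerK k0 x) memvZ in xNU.
Qed.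

(** The matrices are indexed by all vectors, with zero rows and columns for the
zero vector, rather than by points: each point then occurs [#|F| - 1] times, and
[no_linear_pentagon] divides by that factor. *)
Definition relmx (R : W -> {vspace W}) : 'M[algC]_#|W| :=
  mxf (fun x y => ((x != 0) && (y \in nonzero_vectors (R x)))%:R).

(** An entry of the product counts the nonzero vectors of an intersection. *)
Lemma relmx_mul (R S : W -> {vspace W}) :
    (forall x y, x != 0 -> y != 0 -> (y \in S x) = (x \in S y)) ->
  relmx R *m relmx S = mxf (fun x y => ((x != 0) && (y != 0))%:R *
     (#|F| ^ \dim (R x :&: S y) - 1)%N%:R).
Proof.
move=> S_sym; rewrite mxf_mul; apply/matrixP => i j; rewrite !mxE.
move: (enum_val i) (enum_val j) => x y.
rewrite -card_nonzero_vectors -sum1_card natr_sum [in RHS]big_mkcond mulr_sumr /=.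
apply: eq_bigr => z _; rewrite !inE memv_cap.
have [x0|x0] := eqVneq x 0; first by rewrite /= !mul0r.
have [y0|y0] := eqVneq y 0; first by rewrite /= andbF mulr0 mul0r.
have [z0|z0] := eqVneq z 0; first by rewrite /= mul0r mulr0.
by rewrite /= S_sym // mul1r -natrM mulnb; case: (_ && _).
Qed.

Lemma relmx_trace (R : W -> {vspace W}) : (forall x, x \in R x) ->
  \tr (relmx R) = (#|F| ^ v - 1)%N%:R.
Proof.
move=> R_refl; rewrite mxf_trace.
have -> : (#|F| ^ v - 1)%N = #|nonzero_vectors {:W}|.
  by rewrite card_nonzero_vectors dim_rowspace.
rewrite -sum1_card natr_sum [RHS]big_mkcond /=.
by apply: eq_bigr => x _; rewrite !inE R_refl memvf; case: eqP.
Qed.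

Variable nb : W -> {vspace W}.
Hypothesis nb_refl : forall x, x \in nb x.
Hypothesis nb_sym : forall x y, (y \in nb x) = (x \in nb y).

(** For [q := #|F|], the hypotheses make points and edges a generalised pentagon of
order (q, q): there are no triangles other than those on a line, and
non-adjacent points have exactly one common neighbour. *)
Lemma no_linear_pentagon :
    v = 5 -> (forall x, x != 0 -> \dim (nb x) = 3) ->
    (forall x y, x != 0 -> y != 0 -> y \notin <[x]>%VS ->
      \dim (nb x :&: nb y) = if y \in nb x then 2 else 1) ->
  False.
Proof.
move=> v5 dim_nb dim_cap.
pose line (x : W) := (<[x]>)%VS; pose full (x : W) := {:W}%VS.
have line_sym x y : x != 0 -> y != 0 -> (y \in line x) = (x \in line y).
  move=> x0 y0; apply/vlineP/vlineP => -[k E].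
    exists k^-1; rewrite E scalerK //.
    by apply: contraNneq y0 => k0; rewrite E k0 scale0r.
  exists k^-1; rewrite E scalerK //.
  by apply: contraNneq x0 => k0; rewrite E k0 scale0r.
have q1 : (1 < q)%N := finNzRing_gt1 F.
have r0 : (q - 1)%:R != 0 :> algC by rewrite pnatr_eq0; lia.
pose r := (q - 1)%:R : algC.
pose E := r^-1 *: relmx line; pose A := r^-1 *: relmx nb.
pose L := r^-1 *: relmx full.
pose m := (q ^ 2 + q + 1)%N; pose n := (q ^ 4 + q ^ 3 + m)%N.
have r1 : (q ^ 1 - 1)%N%:R = r by rewrite expn1.
have r3 : (q ^ 3 - 1)%N%:R = r * m%:R.
  by rewrite /r -natrM /m; congr (_%:R); nia.
have r5 : (q ^ v - 1)%N%:R = r * n%:R.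
  by rewrite v5 /r -natrM /n /m; congr (_%:R); nia.
(* All the matrix products except [A *m A] are multiples of one of the three
   matrices. *)
have mulE (R S T : W -> {vspace W}) (k : algC) :
    (forall x y, x != 0 -> y != 0 -> (y \in S x) = (x \in S y)) ->
    (forall x y, x != 0 -> y != 0 ->
      (q ^ \dim (R x :&: S y) - 1)%N%:R = r * k * (y \in T x)%:R) ->
  (r^-1 *: relmx R) *m (r^-1 *: relmx S) = k *: (r^-1 *: relmx T).
  move=> S_sym RS; rewrite -scalemxAl -scalemxAr relmx_mul //.
  apply/matrixP => i j; rewrite !mxE.
  move: (enum_val i) (enum_val j) => x y.
  have [x0|x0] := eqVneq x 0; first by rewrite /= mul0r !mulr0.
  have [y0|y0] := eqVneq y 0; first by rewrite /= !inE y0 eqxx mul0r !mulr0.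
  by rewrite RS // !inE y0 /=; field.
have nb_line x y : y \in line x -> (nb x <= nb y)%VS.
  move=> /vlineP[k ->]; apply/subvP => z; rewrite nb_sym => xz.
  by rewrite nb_sym memvZ.
have qb (b : bool) : (q ^ b - 1)%N%:R = r * 1 * b%:R.
  by case: b; rewrite ?r1 ?mulr1 // expn0 subnn mulr0.
have fullP (x y : W) : x != 0 -> y != 0 -> (y \in full x) = (x \in full y).
  by rewrite !memvf.
have nbP (x y : W) : x != 0 -> y != 0 -> (y \in nb x) = (x \in nb y).
  by move=> _ _; apply: nb_sym.
have EE : E *m E = E.
  rewrite [LHS](mulE line line line 1) ?scale1r // => x y x0 y0.
  by rewrite dim_line_cap // qb line_sym.
have EA : E *m A = A.
  rewrite [LHS](mulE line nb nb 1) ?scale1r // => x y x0 y0.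
  by rewrite dim_line_cap // qb nb_sym.
have AE : A *m E = A.
  rewrite [LHS](mulE nb line nb 1) ?scale1r // => x y x0 y0.
  by rewrite capvC dim_line_cap // qb.
have EL : E *m L = L.
  rewrite [LHS](mulE line full full 1) ?scale1r // => x y x0 y0.
  by rewrite dim_line_cap // qb !memvf.
have LE : L *m E = L.
  rewrite [LHS](mulE full line full 1) ?scale1r // => x y x0 y0.
  by rewrite capvC dim_line_cap // qb !memvf.
have AL : A *m L = m%:R *: L.
  apply: mulE => // x y x0 y0.
  by rewrite capvf dim_nb // r3 memvf mulr1.
have LA : L *m A = m%:R *: L.
  apply: mulE => // x y x0 y0.
  by rewrite capfv dim_nb // r3 memvf mulr1.
have LL : L *m L = n%:R *: L.
  apply: mulE => // x y x0 y0.
  by rewrite capvf dim_rowspace r5 memvf mulr1.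
have AA : A *m A = L + q%:R *: A + (q ^ 2)%:R *: E.
  rewrite /A -scalemxAl -scalemxAr relmx_mul //.
  apply/matrixP => i j; rewrite !mxE.
  move: (enum_val i) (enum_val j) => x y.
  have [x0|x0] := eqVneq x 0; first by rewrite /= mul0r !mulr0 !addr0.
  have [y0|y0] := eqVneq y 0.
    by rewrite /= !inE y0 eqxx mul0r !mulr0 !addr0.
  rewrite !inE y0 /= mul1r memvf.
  have rE : r = q%:R - 1 by rewrite /r natrB // ltnW.
  have [yx|yNx] := boolP (y \in <[x]>%VS).
    have xy : x \in line y by rewrite line_sym.
    have -> : nb y = nb x by apply/eqP; rewrite eqEsubv !nb_line.
    have ynx : y \in nb x by rewrite (subvP (nb_line y x xy)).
    rewrite capvv dim_nb // r3 ynx /m !natrD natrX /=; field.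
    exact: r0.
  rewrite dim_cap //; case: ifP => _.
    have -> : (q ^ 2 - 1)%N%:R = r * (q%:R + 1).
      by rewrite /r natr1 -natrM; congr (_%:R); nia.
    by rewrite natrX /=; field; exact: r0.
  by rewrite r1 natrX /=; field; exact: r0.
have tr (R : W -> {vspace W}) : (forall x, x \in R x) ->
    \tr (r^-1 *: relmx R) = n%:R.
  move=> R_refl; rewrite mxtraceZ relmx_trace // r5 mulKf //.
apply: (@pentagon_matrices_absurd _ (sqrtC 5) _ q m n E A L) => //.
- by rewrite sqrtCK.
- by apply: tr => x; apply: memv_line.
- exact: tr.
- by apply: tr => x; apply: memvf.
Qed.
End Pentagon.

(** * Solving the parameter equation *)

(** Cancel the powers of q, using that q^n - 1 is prime to q: this leaves a = k and
(q^k - 1)(q - 1) = (q^s - 1)(q^b - 1) with s = v - k - 1.  If s and b were both at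
least 2, expanding modulo q^2 would give a contradiction. *)
Lemma gaussian_parameters (q v k a b : nat) :
    (1 < q)%N -> (0 < a)%N -> (a <= k)%N -> (0 < b)%N -> (k.+1 < v)%N ->
    ((q ^ k.+1 - q) * (q ^ k.+1 - q ^ a) = (q ^ v - q ^ k.+1) * (q ^ b - 1))%N ->
  a = k /\ ((v = k.+2 /\ b = k) \/ (b = 1 /\ v = (2 * k).+1)).
Proof.
move=> q1 a0 ak b0 kv.
have q0 : (0 < q)%N by lia.
have coq n : (0 < n)%N -> coprime q (q ^ n - 1).
  move=> n0; apply: (@coprime_dvdl _ (q ^ n)); first by rewrite dvdn_exp.
  by rewrite subn1 coprimenP // expn_gt0 q0.
have pge1 n : (0 < q ^ n)%N by rewrite expn_gt0 q0.
pose i := (k.+1 - a)%N; pose s := (v - k.+1)%N.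
have i0 : (0 < i)%N by lia.
have s0 : (0 < s)%N by lia.
have kE : k.+1 = (a + i)%N by lia.
have vE : v = (k.+1 + s)%N by lia.
have -> : (q ^ k.+1 - q = q * (q ^ k - 1))%N by rewrite expnS mulnBr muln1.
have -> : (q ^ k.+1 - q ^ a = q ^ a * (q ^ i - 1))%N.
  by rewrite kE expnD mulnBr muln1.
have -> : (q ^ v - q ^ k.+1 = q ^ a * q * (q ^ i.-1 * (q ^ s - 1)))%N.
  by rewrite vE expnD kE -{1 2}(prednK i0) expnD expnS; nia.
move=> E; have {E} E : ((q ^ k - 1) * (q ^ i - 1) =
    q ^ i.-1 * ((q ^ s - 1) * (q ^ b - 1)))%N.
  have /eqP : (q ^ a * q * ((q ^ k - 1) * (q ^ i - 1)) =
    q ^ a * q * (q ^ i.-1 * ((q ^ s - 1) * (q ^ b - 1))))%N by nia.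
  by rewrite eqn_pmul2l ?muln_gt0 ?pge1 // => /eqP.
have i1 : i = 1%N.
  case: (posnP i.-1) => [|i1]; first by lia.
  have : coprime q ((q ^ k - 1) * (q ^ i - 1)).
    by rewrite coprimeMr !coq //; lia.
  rewrite E -(prednK i1) expnS -mulnA coprimeMr /coprime gcdnn.
  by case/andP => /eqP; lia.
split; first by lia.
rewrite i1 expn1 mul1n in E.
have [s1|s1] := eqVneq s 1%N.
  left; split; first by lia.
  rewrite s1 expn1 mulnC in E.
  have /eqP : (q ^ k - 1 = q ^ b - 1)%N.
    by apply/eqP; rewrite -(eqn_pmul2l (m := q - 1)) ?E //; lia.
  have [] := (pge1 k, pge1 b); rewrite -(eqn_add2r 1) => pk pb.
  by rewrite !subnK // eqn_exp2l // => /eqP.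
have [b1|b1] := eqVneq b 1%N.
  right; split => //.
  rewrite b1 expn1 in E.
  have /eqP : (q ^ k - 1 = q ^ s - 1)%N.
    by apply/eqP; rewrite -(eqn_pmul2r (m := q - 1)) ?E //; lia.
  have [] := (pge1 k, pge1 s); rewrite -(eqn_add2r 1) => pk ps.
  by rewrite !subnK // eqn_exp2l // => /eqP; lia.
exfalso.
have sq n : (1 < n)%N -> (q * q %| q ^ n)%N by exact: (@dvdn_exp2l q 2).
have sqs : (q * q %| q ^ s)%N by apply: sq; lia.
have sqb : (q * q %| q ^ b)%N by apply: sq; lia.
have [k1|k1] := eqVneq k 1%N.
  have big n : (q * q %| q ^ n)%N -> (q <= q ^ n - 1)%N.
    by move/(dvdn_leq (pge1 n)) => qn; have : (q * 2 <= q ^ n)%N; nia.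
  have := leq_mul (big s sqs) (big b sqb); rewrite -E k1 expn1.
  by case: (q) q0 => // p _; nia.
have sqk : (q * q %| q ^ k)%N by apply: sq; lia.
have E' : (q ^ k * q + q ^ s + q ^ b = q ^ s * q ^ b + q ^ k + q)%N.
  move: E (pge1 k) (pge1 s) (pge1 b); clear -q0.
  move: (q ^ k)%N (q ^ s)%N (q ^ b)%N => K X Y.
  case: q q0 => // p _; case: K => // K; case: X => // X; case: Y => // Y.
  by rewrite !subn1 /= => E _ _ _; nia.
have : (q * q %| q ^ s * q ^ b + q ^ k + q)%N.
  rewrite -E'; apply: dvdn_add sqb; apply: dvdn_add sqs.
  exact: dvdn_mulr sqk.
rewrite dvdn_addr; last by apply: dvdn_add sqk; apply: dvdn_mulr sqs.
by move/(dvdn_leq q0); rewrite leqNgt ltn_Pmull.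
Qed.

(** * Counting vectors, points and neighbours *)

Section Counting.
Variables (F : finFieldType) (v : nat).
Local Notation W := 'rV[F]_v.
Implicit Types (U X : {vspace W}) (x y z : W).

(** Used for the points of a subspace and for the elements of a spread. *)
Lemma card_nonzero_partition (S : {set {vspace W}}) (d : nat) U :
    {in S, forall X, \dim X = d} -> {in S, forall X, (X <= U)%VS} ->
    (forall x, x != 0 -> x \in U -> exists! X, X \in S /\ x \in X) ->
  (#|S| * (#|F| ^ d - 1) = #|F| ^ \dim U - 1)%N.
Proof.
move=> dimS subS uniqS.
have -> : (#|S| * (#|F| ^ d - 1) = \sum_(X in S) #|nonzero_vectors X|)%N.
  rewrite (eq_bigr (fun=> (#|F| ^ d - 1)%N)) ?sum_nat_const // => X XS.
  by rewrite card_nonzero_vectors dimS.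
rewrite -card_nonzero_vectors -sum1_card.
under eq_bigr do rewrite -sum1_card big_mkcond /=.
rewrite exchange_big [RHS]big_mkcond /=; apply: eq_bigr => x _.
rewrite -big_mkcondr /= inE; case: (eqVneq x 0) => [->|x0] /=.
  by rewrite big1 // => X; rewrite inE eqxx andbF.
case: ifP => [xU|xNU].
  have [X [[XS xX] Xuniq]] := uniqS x x0 xU.
  rewrite (big_pred1 X) // => Y; rewrite inE x0 /=.
  by apply/andP/eqP => [[YS xY]|->//]; rewrite (Xuniq Y).
rewrite big1 // => X; rewrite inE x0 /= => /andP[XS xX].
by rewrite (subvP (subS X XS)) in xNU.
Qed.

Lemma vertex_line x : x != 0 -> <[x]>%VS \in vertices W.
Proof. by move=> x0; rewrite inE dim_vline x0. Qed.

Lemma vertexP X : X \in vertices W -> exists2 x, x != 0 & X = <[x]>%VS.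
Proof.
rewrite inE => /eqP dX.
have x0 : vpick X != 0 by rewrite vpick0 -dimv_eq0 dX.
exists (vpick X) => //; apply/eqP; rewrite eq_sym eqEdim dX dim_vline x0 leqnn.
by rewrite -memvE memv_pick.
Qed.

Lemma line_eq x y : x != 0 -> y != 0 -> (<[y]> == <[x]>)%VS = (y \in <[x]>%VS).
Proof. by move=> x0 y0; rewrite eqEdim !dim_vline x0 y0 leqnn andbT. Qed.

Lemma mem_points x U : x != 0 -> (<[x]>%VS \in points U) = (x \in U).
Proof. by move=> x0; rewrite inE dim_vline x0. Qed.

Lemma card_points U : (#|points U| * (#|F| ^ 1 - 1) = #|F| ^ \dim U - 1)%N.
Proof.
apply: card_nonzero_partition => [X|X|x x0 xU].
- by rewrite inE => /andP[/eqP].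
- by rewrite inE => /andP[].
exists <[x]>%VS; split; first by rewrite mem_points // memv_line.
move=> X [XU xX]; have Xv : X \in vertices W.
  by move: XU; rewrite !inE => /andP[].
have [y y0 XE] := vertexP Xv; move: xX; rewrite XE => xy.
by apply/eqP; rewrite line_eq.
Qed.

Lemma eq_card_points_dim U X : #|points U| = #|points X| -> \dim U = \dim X.
Proof.
move=> UX; have := card_points U; rewrite UX card_points => E.
have q1 := finNzRing_gt1 F.
have pos n : (0 < #|F| ^ n)%N by rewrite expn_gt0 ltnW.
by apply: (expnI q1); rewrite -(subnK (pos (\dim U))) -(subnK (pos (\dim X))) E.
Qed.

Lemma dim2P U : \dim U = 2 ->
  exists x y, [/\ x != 0, y != 0, y \notin <[x]>%VS & U = (<[x]> + <[y]>)%VS].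
Proof.
move=> dU; pose x := vpick U.
have x0 : x != 0 by rewrite vpick0 -dimv_eq0 dU.
have /subvPn[y yU yNx] : ~~ (U <= <[x]>)%VS.
  by apply/negP => /dimvS; rewrite dU dim_vline x0.
have y0 : y != 0 by apply: contraNneq yNx => ->; apply: mem0v.
exists x, y; split => //; apply/eqP; rewrite eq_sym eqEdim subv_add -!memvE.
rewrite memv_pick yU dU /=.
have : (\dim <[x]> < \dim (<[x]> + <[y]>))%N.
  rewrite (ltn_leqif (dimv_leqif_sup (addvSl _ _))) subv_add subvv /=.
  by rewrite -memvE.
by rewrite dim_vline x0.
Qed.

Lemma card_vspaceD U X :
  #|[set x in U | x \notin X]| = (#|F| ^ \dim U - #|F| ^ \dim (U :&: X))%N.
Proof.
rewrite -!card_vspace -(cardID [pred x | x \in X] U).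
have -> : #|(U :&: X)%VS| = #|[predI U & [pred x | x \in X]]|.
  by apply: eq_card => x; rewrite memv_cap !inE.
by rewrite addKn cardsE; apply: eq_card => x; rewrite !inE andbC.
Qed.

Section DoubleCounting.
Variables (nb : W -> {vspace W}) (k a b : nat).
Hypothesis nb_sym : forall x y, (y \in nb x) = (x \in nb y).
Hypothesis dim_nb : forall x, x != 0 -> \dim (nb x) = k.+1.
Hypothesis nb_refl : forall x, x \in nb x.

(** Both sides count the pairs (y, z) with y in [nb x] off the line of [x] and z in
[nb y] but not in [nb x]. *)
Lemma neighbour_double_count x : x != 0 ->
    (forall y, y != 0 -> y \notin <[x]>%VS -> y \in nb x ->
       \dim (nb x :&: nb y) = a) ->
    (forall y, y != 0 -> y \notin <[x]>%VS -> y \notin nb x ->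
       \dim (nb x :&: nb y) = b) ->
  ((#|F| ^ k.+1 - #|F|) * (#|F| ^ k.+1 - #|F| ^ a) =
    (#|F| ^ v - #|F| ^ k.+1) * (#|F| ^ b - 1))%N.
Proof.
move=> x0 dimA dimB; pose line := <[x]>%VS.
pose D := [set y in nb x | y \notin line]; pose C := [set z in {:W}%VS | z \notin nb x].
have cD : #|D| = (#|F| ^ k.+1 - #|F|)%N.
  rewrite card_vspaceD dim_nb // (capv_idPr _) ?dim_vline ?x0 //.
  by rewrite -memvE.
have cC : #|C| = (#|F| ^ v - #|F| ^ k.+1)%N.
  by rewrite card_vspaceD capfv dim_nb // dim_rowspace.
have l1 : (\sum_(y in D) #|[set z in nb y | z \notin nb x]| =
    #|D| * (#|F| ^ k.+1 - #|F| ^ a))%N.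
  rewrite -sum_nat_const; apply: eq_bigr => y; rewrite inE => /andP[yx yNx].
  have y0 : y != 0 by apply: contraNneq yNx => ->; apply: mem0v.
  by rewrite card_vspaceD dim_nb // capvC dimA.
have l2 : (\sum_(z in C) #|nonzero_vectors (nb x :&: nb z)| =
    #|C| * (#|F| ^ b - 1))%N.
  rewrite -sum_nat_const; apply: eq_bigr => z; rewrite inE memvf /= => zNx.
  have z0 : z != 0 by apply: contraNneq zNx => ->; apply: mem0v.
  rewrite card_nonzero_vectors dimB //; apply: contra zNx => /vlineP[t ->].
  by rewrite memvZ.
rewrite -cD -cC -l1 -l2.
under eq_bigr do rewrite -sum1_card big_mkcond /=.
under [RHS]eq_bigr do rewrite -sum1_card big_mkcond /=.
rewrite exchange_big [RHS]big_mkcond /=; apply: eq_bigr => z _.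
rewrite -!big_mkcondr /= !inE memvf /=; case: (boolP (z \in nb x)) => zx /=.
  by rewrite big1 // => y; rewrite !inE zx !andbF.
apply: eq_bigl => y; rewrite !inE memv_cap zx andbT (nb_sym y z).
case: (boolP (y \in nb x)) => yx /=; last by rewrite andbF.
rewrite andbC [RHS]andbC; case: (boolP (y \in nb z)) => //= yz.
apply/idP/idP => [|y0]; first by apply: contraNneq => ->; apply: mem0v.
apply: contra zx => /vlineP[t yE].
have t0 : t != 0 by apply: contraNneq y0 => t0; rewrite yE t0 scale0r.
by rewrite nb_sym -(scalerK t0 x) -yE memvZ.
Qed.

End DoubleCounting.

(** * The neighbour spaces of a strongly regular graph *)

Section Neighbourhoods.
Variables (G : qgraph W) (k : nat).
Hypothesis G_reg : qregular G k.

(** The value at 0 is chosen so that [y \in nbspace x] is reflexive and symmetric on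
all vectors, zero included. *)
Definition nbspace (x : W) : {vspace W} :=
  if x == 0 then fullv else (\sum_(Y in nbhd G <[x]>) Y)%VS.

Lemma nbspaceP x : x != 0 ->
  \dim (nbspace x) = k.+1 /\ nbhd G <[x]> = points (nbspace x).
Proof.
move=> x0; rewrite /nbspace (negPf x0).
have [U dU ->] := G_reg (vertex_line x0).
suff -> : (\sum_(Y in points U) Y)%VS = U by [].
apply/eqP; rewrite eqEsubv; apply/andP; split.
  by apply/subv_sumP => Y; rewrite inE => /andP[].
apply/subvP => u uU; have [->|u0] := eqVneq u 0; first exact: mem0v.
by rewrite memvE (sumv_sup <[u]>%VS) // mem_points.
Qed.

Lemma mem_nbspace x y : x != 0 -> y != 0 ->
  (y \in nbspace x) = (y \in <[x]>%VS) || ((<[x]> + <[y]>)%VS \in edges G).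
Proof.
move=> x0 y0; rewrite -mem_points // -(nbspaceP x0).2 inE vertex_line //=.
by rewrite line_eq.
Qed.

Lemma nbspace_refl x : x \in nbspace x.
Proof.
have [->|x0] := eqVneq x 0; first exact: mem0v.
by rewrite mem_nbspace // memv_line.
Qed.

Lemma nbspace_sym x y : (y \in nbspace x) = (x \in nbspace y).
Proof.
have [->|x0] := eqVneq x 0; first by rewrite /nbspace eqxx memvf mem0v.
have [->|y0] := eqVneq y 0; first by rewrite /nbspace eqxx memvf mem0v.
by rewrite !mem_nbspace // addvC -(line_eq x0 y0) eq_sym line_eq.
Qed.

Lemma dim_nbspace x : x != 0 -> \dim (nbspace x) = k.+1.
Proof. by move/nbspaceP => []. Qed.

Lemma edge_nbspace x y : x != 0 -> y != 0 -> y \notin <[x]>%VS ->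
  ((<[x]> + <[y]>)%VS \in edges G) = (y \in nbspace x).
Proof. by move=> x0 y0 yNx; rewrite mem_nbspace // (negPf yNx). Qed.

Variables (lambda mu : int).
Hypothesis G_srg : strongly_regular G k lambda mu.

Lemma card_common_points x y : x != 0 -> y != 0 -> y \notin <[x]>%VS ->
  Posz #|points (nbspace x :&: nbspace y)| =
    if y \in nbspace x then lambda + 2 else mu.
Proof.
move=> x0 y0 yNx.
have Nxy : <[x]>%VS != <[y]>%VS by rewrite eq_sym line_eq.
have := G_srg.2 _ _ (vertex_line x0) (vertex_line y0) Nxy.
rewrite /adjacent edge_nbspace // (nbspaceP x0).2 (nbspaceP y0).2.
have -> : points (nbspace x) :&: points (nbspace y) =
    points (nbspace x :&: nbspace y).
  by apply/setP => X; rewrite !inE subv_cap; case: (\dim X == 1%N).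
set P := points _; set Q := [set _; _].
have cQ : #|Q| = 2 by rewrite cards2 Nxy.
have xyP : (x \in nbspace x :&: nbspace y)%VS = (y \in nbspace x).
  by rewrite memv_cap nbspace_refl nbspace_sym.
have yxP : (y \in nbspace x :&: nbspace y)%VS = (y \in nbspace x).
  by rewrite memv_cap nbspace_refl andbT.
case: (boolP (y \in nbspace x)) => yx <-.
  have QP : Q \subset P by rewrite subUset !sub1set !mem_points // xyP yxP yx.
  by rewrite -(cardsID Q P) (setIidPr QP) cQ addrC.
suff -> : P :\: Q = P by [].
apply/setP => X; rewrite in_setD in_set2.
case: eqP => [->|_]; first by rewrite mem_points // xyP (negPf yx).
by case: eqP => [->|//]; rewrite mem_points // yxP (negPf yx).
Qed.

(** Strong regularity fixes the number of common points, and a subspace is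
determined in dimension by its number of points. *)
Lemma dim_common x y x' y' : x != 0 -> y != 0 -> y \notin <[x]>%VS ->
    x' != 0 -> y' != 0 -> y' \notin <[x']>%VS ->
    (y \in nbspace x) = (y' \in nbspace x') ->
  \dim (nbspace x :&: nbspace y) = \dim (nbspace x' :&: nbspace y').
Proof.
move=> x0 y0 yNx x0' y0' yNx' adj; apply: eq_card_points_dim.
by apply/eqP; rewrite -eqz_nat !card_common_points // adj.
Qed.

(** The spread consists of the neighbour spaces themselves: under the hypothesis
two of them that share a point coincide. *)
Lemma spread_of_transitive :
    (forall x y, x != 0 -> y != 0 -> y \in nbspace x -> nbspace y = nbspace x) ->
  exists S : {set {vspace W}},
    [/\ spread k.+1 S,
        #|S|%:R = (#|F|%:R ^+ v - 1) / (#|F|%:R ^+ k.+1 - 1) :> rat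
      & edges G = \bigcup_(U in S) complete_edges U].
Proof.
move=> trans; pose S := nbspace @: [set x | x != 0].
have S_uniq x : x != 0 -> exists! X, X \in S /\ x \in X.
  move=> x0; exists (nbspace x); split.
    by rewrite nbspace_refl; split=> //; apply: imset_f; rewrite inE.
  move=> X [/imsetP[z zS ->] xz]; rewrite inE in zS; exact: trans.
have S_dim : {in S, forall U, \dim U = k.+1}.
  by move=> X /imsetP[x]; rewrite inE => x0 ->; apply: dim_nbspace.
have q1 := finNzRing_gt1 F.
exists S; split.
- by split=> [|X /vertexP[x x0 ->]]; [apply: S_dim | apply: S_uniq].
- have cast n : (#|F| ^ n - 1)%:R = #|F|%:R ^+ n - 1 :> rat.
    by rewrite natrB ?natrX // expn_gt0 ltnW.
  have := card_nonzero_partition S_dim (fun X _ => subvf X)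
    (fun x xN _ => S_uniq x xN).
  rewrite dim_rowspace => /(congr1 (fun n => n%:R : rat)).
  rewrite natrM !cast => <-.
  rewrite mulfK // -natrX subr_eq0 pnatr_eq1.
  by rewrite -(expn0 #|F|) eqn_exp2l.
apply/setP => L; apply/idP/bigcupP => [LG|[X /imsetP[z]]].
  have dL := edges_dim LG; have [x [y [x0 y0 yNx LE]]] := dim2P dL.
  exists (nbspace x); first by apply: imset_f; rewrite inE.
  rewrite inE dL eqxx LE subv_add -!memvE nbspace_refl.
  by rewrite -edge_nbspace // -LE.
rewrite inE => z0 ->; rewrite inE => /andP[/eqP dL].
have [x [y [x0 y0 yNx ->]]] := dim2P dL; rewrite subv_add -!memvE.
by case/andP=> xz yz; rewrite edge_nbspace // (trans z x z0 x0 xz).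
Qed.

Lemma polarity_of_hyperplanes :
    v = k.+2 -> (forall x y, x != 0 -> y != 0 -> nbspace x = nbspace y ->
      y \in <[x]>%VS) ->
  ~~ odd v /\
  exists2 phi : {vspace W} -> {vspace W}, symplectic_polarity phi
    & edges G = [set L : {vspace W} | (\dim L == 2)%N & totally_isotropic phi L].
Proof.
move=> vk inj.
have dim_nb x : x != 0 -> (\dim (nbspace x)).+1 = \dim {:W}.
  by move=> x0; rewrite dim_nbspace // dim_rowspace.
have W0 : (0 < \dim {:W})%N by rewrite dim_rowspace vk.
have [f [falt fE]] := null_polarity_form nbspace_refl nbspace_sym dim_nb inj W0.
have nondeg : orthov f fullv = 0%VS.
  apply/eqP; rewrite -subv0; apply/subvP => x /mem_orthovP fx.
  rewrite memv0; apply: contraT => x0.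
  have /dimvS : (fullv <= nbspace x)%VS.
    by apply/subvP => y _; rewrite -fE fx ?memvf.
  by rewrite -(dim_nb x x0) ltnn.
split.
  have := @alternating_even_dim _ _ f fullv falt.
  by rewrite nondeg capv0 dim_rowspace; apply.
exists (orthov f); first by exists f; split=> //; rewrite /nondegenerate nondeg.
apply/setP => L; rewrite inE.
case: (eqVneq (\dim L) 2) => [dL|dLN]; last first.
  by apply/negbTE; apply: contra dLN => /edges_dim ->.
have [x [y [x0 y0 yNx ->]]] := dim2P dL.
rewrite edge_nbspace // -fE /totally_isotropic /=.
apply/eqP/orthovP => [fxy|->//]; last 2 first.
- by rewrite memvE addvSl.
- by rewrite memvE addvSr.
have fyx : f y x = 0 by rewrite hermC fxy /= mulr0.
move=> u w /memv_addP[_ /vlineP[a1 ->] [_ /vlineP[b1 ->] ->]].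
case/memv_addP=>[_ /vlineP[a2 ->] [_ /vlineP[b2 ->] ->]].
by rewrite !linearDl !linearDr /= !linearZl_LR !linearZr_LR /= !falt fxy fyx !mulr0 !addr0.
Qed.

(** An adjacent pair with different neighbour spaces yields a non-adjacent pair with
a common neighbour; so a and b are both realised, and the parameter equation
leaves null polarities and the excluded family b = 1, v = 2k+1.  Injectivity on
points comes from a = k: neighbour spaces of distinct points never coincide. *)
Lemma nonspread_parameters x0 y0 :
    x0 != 0 -> y0 != 0 -> y0 \in nbspace x0 -> nbspace y0 <> nbspace x0 ->
  v = k.+2 /\ (forall x y, x != 0 -> y != 0 -> nbspace x = nbspace y ->
    y \in <[x]>%VS).
Proof.
move=> x0N y0N yx nbN.
have q1 := finNzRing_gt1 F.
have line_sub x y : y \in <[x]>%VS -> (nbspace x <= nbspace y)%VS.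
  move=> /vlineP[t ->]; apply/subvP => z; rewrite nbspace_sym => xz.
  by rewrite nbspace_sym memvZ.
have yNx : y0 \notin <[x0]>%VS.
  apply/negP => xy; apply: nbN; apply/eqP; rewrite eqEsubv line_sub ?line_sub //.
  by rewrite -line_eq // eq_sym line_eq.
have [z0 zy zNx] : exists2 z, z \in nbspace y0 & z \notin nbspace x0.
  apply/subvPn/negP => sub; apply: nbN; apply/eqP.
  by rewrite eqEdim sub !dim_nbspace // leqnn.
have z0N : z0 != 0 by apply: contraNneq zNx => ->; apply: mem0v.
have zNlx : z0 \notin <[x0]>%VS.
  by apply: contra zNx => /vlineP[t ->]; rewrite memvZ // nbspace_refl.
pose a := \dim (nbspace x0 :&: nbspace y0).
pose b := \dim (nbspace x0 :&: nbspace z0).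
have dimA x y : x != 0 -> y != 0 -> y \notin <[x]>%VS -> y \in nbspace x ->
    \dim (nbspace x :&: nbspace y) = a.
  by move=> xN yN yNlx ynx; apply: dim_common => //; rewrite ynx yx.
have dimB x y : x != 0 -> y != 0 -> y \notin <[x]>%VS -> y \notin nbspace x ->
    \dim (nbspace x :&: nbspace y) = b.
  move=> xN yN yNlx ynx; apply: dim_common => //.
  by rewrite (negPf ynx) (negPf zNx).
have a_gt0 : (0 < a)%N.
  have : (<[x0]> <= nbspace x0 :&: nbspace y0)%VS.
    by rewrite -memvE memv_cap nbspace_refl nbspace_sym.
  by move/dimvS; rewrite dim_vline x0N.
have b_gt0 : (0 < b)%N.
  have : (<[y0]> <= nbspace x0 :&: nbspace z0)%VS.
    by rewrite -memvE memv_cap yx nbspace_sym.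
  by move/dimvS; rewrite dim_vline y0N.
have a_le : (a <= k)%N.
  rewrite -ltnS -(dim_nbspace y0N) /a (ltn_leqif (dimv_leqif_sup (capvSr _ _))).
  by apply/negP => /subvP/(_ _ zy); rewrite memv_cap (negPf zNx).
have kv : (k.+1 < v)%N.
  have : (\dim (nbspace x0) < \dim {:W})%N.
    rewrite (ltn_leqif (dimv_leqif_sup (subvf _))).
    by apply/negP => /subvP/(_ z0 (memvf _)); rewrite (negPf zNx).
  by rewrite dim_nbspace // dim_rowspace.
have count := neighbour_double_count nbspace_sym dim_nbspace nbspace_refl x0N
  (fun y yN => dimA x0 y x0N yN) (fun y yN => dimB x0 y x0N yN).
have [ak cases] := gaussian_parameters q1 a_gt0 a_le b_gt0 kv count.
have vk : v = k.+2.
  case: cases => [[]//|[b1 vE]].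
  (* In N(y0), of dimension k+1, the traces of N(x0) and N(z0) have dimension k,
     and they meet inside a space of dimension b = 1. *)
  have k2 : (k <= 2)%N.
    have cap_y : (nbspace x0 :&: nbspace y0 :&: (nbspace z0 :&: nbspace y0)
        <= nbspace x0 :&: nbspace z0)%VS by rewrite capvS // capvSl.
    have := dimvS cap_y; rewrite -/b b1.
    have := dimv_sum_cap (nbspace x0 :&: nbspace y0) (nbspace z0 :&: nbspace y0).
    have dimz : \dim (nbspace z0 :&: nbspace y0) = a.
      rewrite dimA // 1?nbspace_sym //.
      apply: contra zNx => zy'.
      rewrite nbspace_sym (subvP (line_sub y0 z0 _)) // -1?nbspace_sym //.
      by rewrite -line_eq // eq_sym line_eq.
    rewrite dimz -/a.
    have : (nbspace x0 :&: nbspace y0 + (nbspace z0 :&: nbspace y0)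
      <= nbspace y0)%VS by rewrite subv_add !capvSr.
    by move/dimvS; rewrite dim_nbspace // ak; lia.
  have [kE|k1] : k = 2 \/ k = 1%N by lia.
    exfalso; apply: (no_linear_pentagon nbspace_refl nbspace_sym).
    - by rewrite vE kE.
    - by move=> x xN; rewrite dim_nbspace // kE.
    move=> x y xN yN yNlx; case: ifP => ynx.
      by rewrite dimA // ak.
    by rewrite dimB ?ynx.
  by rewrite vE k1.
split=> // x y xN yN nbE.
apply: contraT => yNlx.
have ynx : y \in nbspace x by rewrite nbE nbspace_refl.
have := dimA x y xN yN yNlx ynx.
by rewrite nbE capvv dim_nbspace // ak => /eqP; rewrite eqn_leq ltnn.
Qed.

End Neighbourhoods.
End Counting.

(** * The classification *)

Theorem theorem4p4 (q : nat) (F : finFieldType) (hq : #|F| = q)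
    (v k : nat) (lambda mu : int) (hv : (1 <= v)%N)
    (G : qgraph 'rV[F]_v) (hG : strongly_regular G k lambda mu) :
  (exists S : {set {vspace 'rV[F]_v}},
     [/\ spread k.+1 S,
         #|S|%:R = (q%:R ^+ v - 1) / (q%:R ^+ k.+1 - 1) :> rat
       & edges G = \bigcup_(U in S) complete_edges U])
  \/
  (~~ odd v /\
   exists2 phi : {vspace 'rV[F]_v} -> {vspace 'rV[F]_v},
     symplectic_polarity phi
   & edges G = [set L : {vspace 'rV[F]_v} | (\dim L == 2)%N & totally_isotropic phi L]).
Proof.
have G_reg : qregular G k by case: hG.
rewrite -{}hq; pose nb := nbspace G.
case: (boolP [forall x, forall y, [&& x != 0, y != 0 & y \in nb x] ==>
  (nb y == nb x)]) => [/forallP trans|].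
  left; apply: spread_of_transitive G_reg _ => x y x0 y0 yx; apply/eqP.
  by have /forallP/(_ y) := trans x; rewrite x0 y0 [y \in _]yx.
case/forallPn => x /forallPn[y]; rewrite negb_imply.
case/andP=> /and3P[x0 y0 yx] /eqP nbN; right.
have [vk inj] := nonspread_parameters G_reg hG x0 y0 yx nbN.
exact: (polarity_of_hyperplanes G_reg vk inj).
Qed.
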